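(* Let $G$ be a threshold graph (with at least one vertex) and let $D$ be an orientation of $G$. Then $D$ has a vertex $v$ with $d^{+}_D(v)\le d^{++}_D(v)$.
   Context: Graphs are finite and simple. An orientation of $G$ is the digraph obtained by replacing each edge of $G$ by exactly one of its two possible arcs. For a vertex $v$ of $D$, $N^{+}_D(v)$ is the set of out-neighbors of $v$ and $d^{+}_D(v)=|N^{+}_D(v)|$. $N^{++}_D(v)$ is the set of vertices at distance exactly 2 from $v$ (out-neighbors of out-neighbors of $v$, excluding $N^{+}_D(v)$); $d^{++}_D(v)=|N^{++}_D(v)|$. A graph $G$ is a threshold graph if, for some $n\ge 0$: (1) $V(G)=\bigcup_{i=1}^{n+1}(X_i\cup A_{i-1})$ with the $A_i$'s and $X_i$'s pairwise disjoint; (2) $K=\bigcup_{i=1}^{n+1}X_i$ is a clique and the $X_i$'s are nonempty, except possibly $X_{n+1}$; (3) $S=\bigcup_{i=0}^{n}A_i$ is a stable set and the $A_i$'s are nonempty, except possibly $A_0$; (4) for all $1\le j\le i\le n$, every vertex of $A_i$ is adjacent to every vertex of $X_j$; (5) $G$ has no other edges. Equivalently (Chvátal–Hammer), $G$ has no induced subgraph isomorphic to $C_4$, $\overline{C_4}$ or $P_4$ (the path on 4 vertices). *)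

(* Defs.v *)
(* A finite simple graph is a symmetric irreflexive boolean relation on a
   finType; a digraph is a boolean relation, d u v standing for the arc u -> v. *)
From mathcomp Require Import all_boot.

Set Implicit Arguments.
Unset Strict Implicit.
Unset Printing Implicit Defensive.

Definition simple_graph (V : finType) (e : rel V) : Prop :=
  symmetric e /\ irreflexive e.

Definition orientation (V : finType) (e d : rel V) : Prop :=
  (forall u v, e u v = d u v || d v u) /\
  (forall u v, ~~ (d u v && d v u)).

Definition out_nbrs (V : finType) (d : rel V) (v : V) : {set V} :=
  [set u | d v u].

(* "Distance exactly 2" rules out v itself, which is at distance 0; when d has
   no 2-cycle, as in an orientation, removing v has no effect. *)
Definition second_out_nbrs (V : finType) (d : rel V) (v : V) : {set V} :=
  (\bigcup_(u in out_nbrs d v) out_nbrs d u) :\: (v |: out_nbrs d v).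

Definition out_degree (V : finType) (d : rel V) (v : V) : nat :=
  #|out_nbrs d v|.

Definition second_out_degree (V : finType) (d : rel V) (v : V) : nat :=
  #|second_out_nbrs d v|.

Definition clique (V : finType) (e : rel V) (K : {set V}) : Prop :=
  {in K &, forall u v, u != v -> e u v}.

Definition stable (V : finType) (e : rel V) (S : {set V}) : Prop :=
  {in S &, forall u v, ~~ e u v}.

(* Only X 1, ..., X n.+1 and A 0, ..., A n are meaningful; the values of the
   families at other indices are unconstrained. *)
Record threshold_partition (V : finType) (e : rel V) (n : nat)
    (X A : nat -> {set V}) : Prop := ThresholdPartition {
  tp_cover : \bigcup_(1 <= i < n.+2) (X i :|: A i.-1) = [set: V];
  tp_disjXX : forall i j, 1 <= i <= n.+1 -> 1 <= j <= n.+1 -> i != j ->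
    [disjoint X i & X j];
  tp_disjAA : forall i j, i <= n -> j <= n -> i != j -> [disjoint A i & A j];
  tp_disjXA : forall i j, 1 <= i <= n.+1 -> j <= n -> [disjoint X i & A j];
  tp_clique : clique e (\bigcup_(1 <= i < n.+2) X i);
  tp_X_nonempty : forall i, 1 <= i <= n -> X i != set0;
  tp_stable : stable e (\bigcup_(0 <= i < n.+1) A i);
  tp_A_nonempty : forall i, 1 <= i <= n -> A i != set0;
  tp_adj : forall i j, 1 <= j <= i -> i <= n ->
    {in A i & X j, forall a x, e a x};
  tp_no_other : forall u v, e u v ->
    (u \in \bigcup_(1 <= i < n.+2) X i /\ v \in \bigcup_(1 <= i < n.+2) X i) \/
    (exists i j, [/\ 1 <= j <= i, i <= n &
       (u \in A i /\ v \in X j) \/ (v \in A i /\ u \in X j)])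
}.

Definition threshold (V : finType) (e : rel V) : Prop :=
  exists (n : nat) (X A : nat -> {set V}), threshold_partition e n X A.

(* Main.v *)
(** A nonedge [u v] may be oriented harmlessly as [u -> v] when every
    in-neighbour of [u] already reaches [v] in at most two steps.  If neither
    direction of a nonedge were harmless, the two witnesses would form an
    alternating 4-cycle with [u] and [v], which a threshold graph excludes.  So
    the orientation extends to a semicomplete digraph [t] by harmless arcs.  The
    last vertex of a median order of [t] then has the second neighbourhood
    property, by the argument of Havet and Thomassé for tournaments. *)
Require Import Defs.
From mathcomp Require Import all_boot.
From mathcomp Require Import zify.

Set Implicit Arguments.
Unset Strict Implicit.
Unset Printing Implicit Defensive.

Lemma sub_in_count (T : eqType) (a1 a2 : pred T) (s : seq T) :
  {in s, subpred a1 a2} -> count a1 s <= count a2 s.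
Proof.
elim: s => //= x s IHs sub.
have /IHs: {in s, subpred a1 a2} by move=> y ys; apply: sub; rewrite inE ys orbT.
by have := sub x (mem_head x s); case: (a1 x) => [->|_]; lia.
Qed.

(** If [a, b] or [u, v] both lie in the clique, that pair is adjacent. Otherwise, up to symmetry,
    [a] is in [A i], [u] in [X j], [v] in [A k] and [b] in [X l], with [j <= i] and [l <= k]: either
    [l <= i] yields [e a b], or [j <= i < l <= k] yields [e u v]. *)
Lemma threshold_no_alternating_C4 (V : finType) (e : rel V) (a b u v : V) :
    symmetric e -> threshold e -> e a u -> e b v -> a != b -> u != v ->
  e a b || e u v.
Proof.
move=> esym [n [X [A [_ _ _ _ clK _ _ _ adj only]]]] eau ebv nab nuv.
have inK i j x : 1 <= j <= i -> i <= n -> x \in X j ->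
    x \in \bigcup_(1 <= i < n.+2) X i.
  move=> ji le_in xX; rewrite (bigD1_seq j) ?iota_uniq //=.
    by rewrite in_setU xX.
  by rewrite mem_index_iota; lia.
case: (only _ _ eau) => [[aK uK]|[i [j [ji le_in [[aA uX]|[uA aX]]]]]];
case: (only _ _ ebv) => [[bK vK]|[k [l [lk le_kn [[bA vX]|[vA bX]]]]]].
all: try solve [rewrite (clK a b) //; eauto].
all: try solve [rewrite (clK u v) ?orbT //; eauto].
- have [le_li|lt_il] := leqP l i.
    by rewrite (adj i l _ _ a b) //; lia.
  by rewrite [e u v]esym (adj k j _ _ v u) ?orbT //; lia.
- have [le_jk|lt_kj] := leqP j k.
    by rewrite esym (adj k j _ _ b a) //; lia.
  by rewrite (adj i l _ _ u v) ?orbT //; lia.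
Qed.

Section MedianOrder.

Variables (T : eqType) (t : rel T).

Fixpoint forward_arcs (s : seq T) : nat :=
  if s is x :: s' then count (t x) s' + forward_arcs s' else 0.

(** Only the pairs formed by [x] and a member of [w] change their relative order. *)
Lemma forward_arcs_move (p w q : seq T) (x : T) :
  forward_arcs (p ++ x :: w ++ q) + count (t^~ x) w =
  forward_arcs (p ++ w ++ x :: q) + count (t x) w.
Proof.
elim: p => [|y p IHp] /=; last first.
  by rewrite !count_cat /= !count_cat; lia.
elim: w => [|y w IHw] /=; first by rewrite addn0.
by move: IHw; rewrite /= !count_cat /=; lia.
Qed.

(** Take a permutation maximizing [forward_arcs]: moving [x] in front of [w] cannot gain. *)
Lemma median_order_exists (s0 : seq T) : exists2 s, perm_eq s s0 &
  forall p w x q, s = p ++ w ++ x :: q -> count (t x) w <= count (t^~ x) w.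
Proof.
pose P n := has (fun s => forward_arcs s == n) (permutations s0).
have exP : exists n, P n.
  exists (forward_arcs s0); apply/hasP; exists s0 => //.
  by rewrite mem_permutations.
have ubP n : P n -> n <= \max_(s <- permutations s0) forward_arcs s.
  by case/hasP=> s s_in /eqP<-; apply: leq_bigmax_seq.
case: (ex_maxnP exP ubP) => m /hasP[s]; rewrite mem_permutations => ss0 /eqP<-.
move=> max_s; exists s => // p w x q def_s.
have := max_s (forward_arcs (p ++ x :: w ++ q)).
have -> : P (forward_arcs (p ++ x :: w ++ q)).
  apply/hasP; exists (p ++ x :: w ++ q) => //; rewrite mem_permutations.
  apply: perm_trans ss0; rewrite def_s perm_cat2l -(cat1s x (w ++ q)).
  by rewrite -(cat1s x q) perm_catCA.
by move=> /(_ isT); have := forward_arcs_move p w q x; rewrite def_s; lia.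
Qed.

(* [P] plays the role of the out-neighbourhood of the last vertex of the order,
   which is itself not listed in [s].  Cut [s] at the first [x] that is neither
   in [P] nor a second neighbour: before [x], vertices of [P] are out-neighbours
   of [x] and in-neighbours of [x] are second neighbours, so the median property
   at [x] handles that part, and induction handles the part after [x]. *)
Lemma median_order_second_nbrs (P : pred T) (s : seq T) :
    {in s &, forall x y, x != y -> t x y || t y x} ->
    (forall p w, s = p ++ w -> count P w <= count (predC P) w) ->
    (forall p w x q, s = p ++ w ++ x :: q ->
       count (t x) w <= count (t^~ x) w) ->
  count P s <= count (fun y => ~~ P y && has (fun u => P u && t u y) s) s.
Proof.
move=> tot lastP med.
pose good y := ~~ P y && has (fun u => P u && t u y) s; rewrite -/good.
suffices suff r p : s = p ++ r -> count P r <= count good r.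
  exact: (suff s [::]).
have [m] := ubnP (size r); elim: m r p => // m IHm r p /ltnSE le_rm def_s.
have [hasr|/hasPn no_bad] := boolP (has (fun x => ~~ P x && ~~ good x) r);
  last first.
  (* Without such an [x], everything in [r] outside [P] is good. *)
  apply: leq_trans (lastP _ _ def_s) _.
  apply: sub_in_count => x /no_bad.
  by rewrite negb_and !negbK /= => /orP[->|].
case: (split_find hasr) def_s le_rm => x w q /andP[nPx ngx] /hasPn no_bad.
rewrite cat_rcons => def_s le_rm.
have IHq : count P q <= count good q.
  apply: (IHm _ (p ++ w ++ [:: x])); last by rewrite def_s -!catA.
  by move: le_rm; rewrite size_cat /=; lia.
have sub_s y : y \in w ++ x :: q -> y \in s.
  by move=> y_in; rewrite def_s mem_cat y_in orbT.
have x_s : x \in s by rewrite sub_s // mem_cat mem_head orbT.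
have not_tx y : y \in s -> P y -> ~~ t y x.
  move=> ys Py; move: ngx; rewrite /good nPx /= => /hasPn/(_ y ys).
  by rewrite Py.
have w_s y : y \in w -> y \in s by move=> yw; rewrite sub_s // mem_cat yw.
have Pw : count P w <= count (t x) w.
  apply: sub_in_count => y yw Py; have ys := w_s y yw.
  have := tot x y x_s ys; rewrite (negPf (not_tx y ys Py)) orbF; apply.
  by apply: contraNneq nPx => ->.
have goodw : count (t^~ x) w <= count good w.
  apply: sub_in_count => y yw tyx; have := no_bad y yw.
  by rewrite negb_and !negbK => /orP[/(not_tx y (w_s y yw))|//]; rewrite tyx.
rewrite !count_cat /= (negPf nPx) add0n.
apply: leq_add (leq_trans IHq (leq_addl _ _)).
exact: leq_trans Pw (leq_trans (med _ _ _ _ def_s) goodw).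
Qed.

End MedianOrder.

Theorem corollary7 (V : finType) (e d : rel V)
  (hV : 0 < #|V|) (hG : simple_graph e) (hT : threshold e)
  (hD : orientation e d) :
  exists v : V, out_degree d v <= second_out_degree d v.
Proof.
case: hG => esym _; case: hD => ed dasym.
pose harmless u v :=
  [forall w, d w u ==> d w v || [exists z, d w z && d z v]].
pose t u v := d u v || ~~ e u v && harmless u v.
have t_total u v : u != v -> t u v || t v u.
  move=> nuv; rewrite /t [e v u]esym.
  have [euv|neuv] := boolP (e u v); first by rewrite !orbF -ed.
  apply/contraT; rewrite !negb_or /= => /andP[/andP[_ nuv_h] /andP[_ nvu_h]].
  case/forallPn: nuv_h => a; rewrite negb_imply negb_or => /and3P[dau ndav].
  move=> /existsPn noav; case/forallPn: nvu_h => b.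
  rewrite negb_imply negb_or => /and3P[dbv ndbu /existsPn nobu].
  have nab : a != b by apply: contraNneq ndav => ->.
  have := threshold_no_alternating_C4 esym hT _ _ nab nuv.
  (* Either orientation of the edge [a b] contradicts a witness, through [a -> b -> v] or
     [b -> a -> u]. *)
  rewrite (negPf neuv) orbF !ed dau dbv => /(_ isT isT) /orP[dab|dba].
  - by have := noav b; rewrite dab dbv.
  - by have := nobu a; rewrite dba dau.
have [L permL med] := median_order_exists t (enum V).
have uniqL : uniq L by rewrite (perm_uniq permL) enum_uniq.
have memL x : x \in L by rewrite (perm_mem permL) mem_enum.
case/lastP: L => [|s f] in permL med uniqL memL *.
  by case/card_gt0P: hV => x _; have := memL x.
have dff : d f f = false by apply/negP => dff; have := dasym f f; rewrite dff.
move: uniqL; rewrite rcons_uniq => /andP[nfs uniqs]; exists f.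
have count_card (P : pred V) : count P s = #|[pred y | (y \in s) && P y]|.
  rewrite -size_filter -(card_uniqP (filter_uniq _ uniqs)).
  by apply: eq_card => y; rewrite mem_filter andbC.
have le_count : count (d f) s <=
    count (fun y => ~~ d f y && has (fun u => d f u && t u y) s) s.
  apply: (median_order_second_nbrs (t := t)).
  - by move=> x y _ _; apply: t_total.
  (* The median property at [f] concerns [t], but [d f] is contained in [t f], and a vertex [y] with
     [t y f] is never in [d f]: either [d y f] holds or [y f] is a nonedge. *)
  - move=> p w def_s.
    have /med : rcons s f = p ++ w ++ f :: [::].
      by rewrite def_s -cats1 catA.
    move=> medw; apply: leq_trans (leq_trans medw _); apply: sub_count => y.
      by rewrite /t /= => ->.
    rewrite /t /= => /orP[dyf|/andP[neyf _]].
      by have := dasym y f; rewrite dyf.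
    by apply: contra neyf; rewrite ed orbC => ->.
  - move=> p w x q def_s; apply: (med p w x (rcons q f)).
    by rewrite def_s -!cats1 -!catA.
rewrite !count_card in le_count; apply: leq_trans (leq_trans le_count _).
  apply: subset_leq_card; apply/subsetP => y; rewrite !inE => dfy.
  have := memL y; rewrite mem_rcons inE dfy andbT => /orP[/eqP yf|//].
  by rewrite yf dff in dfy.
apply: subset_leq_card; apply/subsetP => y; rewrite !inE.
move=> /and3P[ys ndfy /hasP[u us /andP[dfu tuy]]].
rewrite negb_or ndfy andbT; apply/andP; split.
  by apply: contraNneq nfs => <-.
(* If [u -> y] is an added arc, harmlessness applied to the in-neighbour [f] of [u] gives a path
   [f -> z -> y] in [d]. *)
case/orP: tuy => [duy|/andP[_ /forallP/(_ f)]].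
  by apply/bigcupP; exists u; rewrite inE.
rewrite dfu (negPf ndfy) /= => /existsP[z /andP[dfz dzy]].
by apply/bigcupP; exists z; rewrite inE.
Qed.
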